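(* For every ordered graph $F$, \[ \rho_{<}(F) = \inf\{\alpha \in [0, 1] : \text{there exists } C \text{ such that every } (\alpha, C)\text{-rich graph contains } F\}. \]
   Context: An ordered graph is a graph whose vertex set carries a total order. An ordered graph $G$ contains an ordered graph $F$ if there is an injective order-preserving map $V(F)\to V(G)$ sending edges of $F$ to edges of $G$; otherwise $G$ is $F$-free. For ordered graphs $F,G$ (with $e(G)>0$), $\rho_{<}(F,G)=\max\{e(G')/e(G): G'\subseteq G,\ G'\ F\text{-free}\}$ and $\rho_{<}(F)=\inf_G\rho_{<}(F,G)$ over all ordered graphs $G$. For distinct $x,y\in\{0,1\}^d$, $\delta(x,y)=\min\{i: x_i\ne y_i\}$; $\{0,1\}^d$ is ordered lexicographically ($x<y$ iff $x_{\delta(x,y)}=0$). For a graph $G$ on $\{0,1\}^d$ (with this order), an edge $uv$ is a level-$\ell$ edge if $\delta(u,v)=\ell$, $e_\ell(G)$ is the number of level-$\ell$ edges, and $\tau_{\ell,d}=2^{2d-\ell-1}$ is the number of pairs $\{u,v\}\subseteq\{0,1\}^d$ with $\delta(u,v)=\ell$. A level $\ell\in[d]$ is $\alpha$-rich for $G$ if $e_\ell(G)\ge\alpha\tau_{\ell,d}$, and $G$ is $(\alpha,C)$-rich if at least $C$ levels $\ell\in[d]$ are $\alpha$-rich. ''Every $(\alpha,C)$-rich graph'' ranges over all $d\in\mathbb{N}$ and all $(\alpha,C)$-rich ordered graphs on $\{0,1\}^d$. *)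

(* Defs.v *)
From HB Require Import structures.
From mathcomp Require Import all_boot all_order all_algebra.
From mathcomp Require Import boolp classical_sets reals.
Set Implicit Arguments. Unset Strict Implicit. Unset Printing Implicit Defensive.
Import Order.TTheory GRing.Theory Num.Theory.

(* An ordered graph on a finite vertex type T with strict total order [lt]
   is represented by its edge set E : {set T * T}, each edge {u,v} stored
   exactly once as the pair (u,v) with lt u v. *)
Definition ograph_on (T : finType) (lt : rel T) (E : {set T * T}) : Prop :=
  forall p, p \in E -> lt p.1 p.2.

Definition ord_lt (n : nat) : rel 'I_n := fun a b => (a < b)%N.

Definition contains (k : nat) (EF : {set 'I_k * 'I_k})
  (T : finType) (lt : rel T) (EG : {set T * T}) : bool :=
  [exists f : {ffun 'I_k -> T},
     [forall a : 'I_k, forall b : 'I_k, (a < b)%N ==> lt (f a) (f b)]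
     && [forall p in EF, (f p.1, f p.2) \in EG]].

Definition rho_FG (R : realType) (k : nat) (EF : {set 'I_k * 'I_k})
  (n : nat) (EG : {set 'I_n * 'I_n}) : R :=
  ((\max_(E' : {set 'I_n * 'I_n} | (E' \subset EG) && ~~ contains EF (@ord_lt n) E')
      #|E'|)%:R / #|EG|%:R)%R.

Definition rho_F (R : realType) (k : nat) (EF : {set 'I_k * 'I_k}) : R :=
  inf [set x : R | exists (n : nat) (EG : {set 'I_n * 'I_n}),
        ograph_on (@ord_lt n) EG /\ (0 < #|EG|)%N /\ x = rho_FG R EF EG].

(* The hypercube {0,1}^d; coordinate i : 'I_d stands for coordinate i+1. *)
Definition cube (d : nat) := {ffun 'I_d -> bool}.

(* delta(x,y) = i+1, i.e. x and y first differ at coordinate i *)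
Definition at_level (d : nat) (x y : cube d) (i : 'I_d) : bool :=
  (x i != y i) && [forall j : 'I_d, (j < i)%N ==> (x j == y j)].

Definition lexlt (d : nat) : rel (cube d) :=
  fun x y => [exists i : 'I_d, at_level x y i && ~~ x i].

Definition tau (l d : nat) : nat := 2 ^ (2 * d - l - 1).

(* e_l(G) for level l = i+1 *)
Definition e_level (d : nat) (E : {set cube d * cube d}) (i : 'I_d) : nat :=
  #|[set p in E | at_level p.1 p.2 i]|.

Definition rich_level (R : realType) (alpha : R) (d : nat)
  (E : {set cube d * cube d}) (i : 'I_d) : bool :=
  (alpha * (tau i.+1 d)%:R <= (e_level E i)%:R)%R.

Definition rich (R : realType) (alpha : R) (C : nat) (d : nat)
  (E : {set cube d * cube d}) : Prop :=
  (C <= #|[set i : 'I_d | rich_level alpha E i]|)%N.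

(* Main.v *)
(* Upper bound.  Give a level-l pair of {0,1}^d a weight proportional to 1/tau_{l,d}, so
   that all d levels have the same total weight.  An F-free graph is not (alpha, C)-rich,
   hence has relative weight at most alpha + C/d.  The weights are then removed by a
   blow-up in which the copies of x and y are joined with density proportional to the
   weight of xy, and in such a way that every edge of the blow-up lies in equally many
   transversal copies of the complete graph, up to the factor given by the weight;
   averaging over these copies bounds rho_<(F, blow-up).

   Lower bound.  Let rho_<(F, G) < alpha with G on n vertices, and let a graph on {0,1}^d
   have n blocks of B rich levels each.  Choose a random level l_t in each block t and a
   random path v forced to turn right at the chosen levels, and let w_t be a random leaf
   leaving v at level l_t.  Then w_1 < ... < w_n, and the pair w_i w_j has level l_i.  It
   would be a uniform pair of that level if the bits of w_j at l_1, ..., l_j were not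
   prescribed; as the l_t are random in large blocks, the law of large numbers in each
   block makes this bias negligible.  So the w_t span on average more than
   rho_<(F, G) e(G) edges of G, which must contain F. *)
Require Import Defs.
From HB Require Import structures.
From mathcomp Require Import all_boot all_order all_algebra.
From mathcomp Require Import boolp classical_sets reals.
From mathcomp Require Import zify ring lra.
From mathcomp Require Import fintype finset.
Import Order.TTheory GRing.Theory Num.Theory.
Set Implicit Arguments. Unset Strict Implicit. Unset Printing Implicit Defensive.
Local Open Scope ring_scope.

(** * Containment, and the ratio for a single host graph *)

Lemma contains_map (k : nat) (EF : {set 'I_k * 'I_k}) (T1 T2 : finType)
    (lt1 : rel T1) (lt2 : rel T2) (E1 : {set T1 * T1}) (E2 : {set T2 * T2})
    (f : T1 -> T2) :
  (forall x y, lt1 x y -> lt2 (f x) (f y)) ->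
  (forall x y, (x, y) \in E1 -> (f x, f y) \in E2) ->
  contains EF lt1 E1 -> contains EF lt2 E2.
Proof.
move=> fmono fE /existsP[g /andP[/forallP gmono /forallP gE]].
apply/existsP; exists [ffun a => f (g a)]; apply/andP; split.
  apply/forallP => a; apply/forallP => b; apply/implyP => ab; rewrite !ffunE.
  by apply: fmono; move/forallP: (gmono a) => /(_ b) /implyP; apply.
apply/forallP => p; apply/implyP => pF; rewrite !ffunE.
by apply: fE; move/implyP: (gE p); apply.
Qed.

(** Nonnegativity of [g] covers a maximum over an empty family, which is 0. *)
Lemma rho_FG_le (R : realType) (k : nat) (EF : {set 'I_k * 'I_k}) (n : nat)
    (EG : {set 'I_n * 'I_n}) (g : R) :
  (0 < #|EG|)%N -> 0 <= g ->
  (forall E' : {set 'I_n * 'I_n}, E' \subset EG ->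
     ~~ contains EF (@ord_lt n) E' -> #|E'|%:R <= g * #|EG|%:R) ->
  rho_FG R EF EG <= g.
Proof.
move=> EG0 g0 H; rewrite /rho_FG ler_pdivrMr ?ltr0n//.
elim/big_ind : _ => [|x y Hx Hy|E' /andP[]].
- by rewrite mulr_ge0.
- by rewrite /maxn; case: ifP.
- exact: H.
Qed.

Lemma le_rho_FG (R : realType) (k : nat) (EF : {set 'I_k * 'I_k}) (n : nat)
    (EG E' : {set 'I_n * 'I_n}) :
  (0 < #|EG|)%N -> E' \subset EG -> ~~ contains EF (@ord_lt n) E' ->
  #|E'|%:R <= rho_FG R EF EG * #|EG|%:R.
Proof.
move=> EG0 E'G E'F; rewrite /rho_FG divfK ?pnatr_eq0 ?lt0n_neq0// ler_nat.
by apply: (@leq_bigmax_cond _ _ (fun E : {set 'I_n * 'I_n} => #|E|)); rewrite E'G.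
Qed.

Lemma rho_FG_ge0 (R : realType) (k : nat) (EF : {set 'I_k * 'I_k}) (n : nat)
    (EG : {set 'I_n * 'I_n}) : 0 <= rho_FG R EF EG.
Proof. by rewrite /rho_FG divr_ge0. Qed.

(** * Transport of finite total orders to ['I_n] *)

Section Rank.
Variables (T : finType) (lt : rel T).
Hypotheses (lt_irr : irreflexive lt) (lt_trans : transitive lt).
Hypothesis (lt_total : forall x y, x != y -> lt x y || lt y x).

Let below (x : T) := #|[set y | lt y x]|.

Lemma below_lt x : (below x < #|T|)%N.
Proof.
rewrite -cardsT; apply: proper_card; apply/properP; split; first exact: subsetT.
by exists x; rewrite ?inE ?lt_irr.
Qed.

Definition order_rank x : 'I_#|T| := Ordinal (below_lt x).

Lemma order_rank_mono x y : lt x y -> ord_lt (order_rank x) (order_rank y).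
Proof.
move=> xy; apply: proper_card; apply/properP; split.
  by apply/subsetP => z; rewrite !inE => /lt_trans; apply.
by exists x; rewrite !inE ?lt_irr.
Qed.

Lemma order_rank_inj : injective order_rank.
Proof.
move=> x y xy; apply/eqP/negPn/negP => /lt_total /orP[] /order_rank_mono;
  by rewrite /ord_lt xy ltnn.
Qed.

(** [rho_F] ranges over hosts on some ['I_n] only; the injective, order-preserving [order_rank]
    carries a host on any finite total order there, and its [F]-free subgraphs pull back. *)
Lemma ograph_to_ord (R : realType) (k : nat) (EF : {set 'I_k * 'I_k})
    (E : {set T * T}) (g : R) :
  ograph_on lt E -> (0 < #|E|)%N -> 0 <= g ->
  (forall E' : {set T * T}, E' \subset E ->
     ~~ contains EF lt E' -> #|E'|%:R <= g * #|E|%:R) ->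
  exists (n : nat) (EG : {set 'I_n * 'I_n}),
    [/\ ograph_on (@ord_lt n) EG, (0 < #|EG|)%N & rho_FG R EF EG <= g].
Proof.
move=> Elt E0 g0 H.
pose h (p : T * T) := (order_rank p.1, order_rank p.2).
have hinj : injective h.
  move=> [a b] [c e] hp; have /order_rank_inj /= -> := congr1 fst hp.
  by have /order_rank_inj /= -> := congr1 snd hp.
have cE : #|h @: E| = #|E| by rewrite card_imset.
exists #|T|, (h @: E); split; rewrite ?cE//.
  by move=> _ /imsetP[p pE ->] /=; apply: order_rank_mono; exact: Elt.
apply: rho_FG_le; rewrite ?cE// => E' E'E E'F.
have -> : E' = h @: (h @^-1: E').
  apply/setP => q; apply/idP/imsetP => [qE'|[p]]; last by rewrite inE => pE' ->.
  by have /imsetP[p _ qp] := subsetP E'E _ qE'; exists p; rewrite // inE -qp.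
rewrite card_imset//; apply: H.
  apply/subsetP => p; rewrite inE => /(subsetP E'E) /imsetP[q qE /hinj ->//].
apply: contra E'F; apply: contains_map; first exact: order_rank_mono.
by move=> x y; rewrite inE.
Qed.

End Rank.

(** * Blow-ups *)

Lemma card_family_prod (I J : finType) (F : I -> pred J) :
  #|family F| = (\prod_i #|F i|)%N.
Proof. by rewrite card_family foldrE big_map big_enum. Qed.

Lemma card_ord_ltn n k : (k <= n)%N -> #|[pred a : 'I_n | (a < k)%N]| = k.
Proof. by move=> kn; rewrite -sum1_card (big_ord_narrow kn) sum1_card card_ord. Qed.

(** Used to count fibres of maps that overwrite some coordinates: those in [P] are free, the others
    are fixed by [b]. *)
Lemma card_agree (I J : finType) (P : pred I) (b : {ffun I -> J}) :
  #|[set z : {ffun I -> J} | [forall t, P t || (z t == b t)]]| = (#|J| ^ #|P|)%N.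
Proof.
pose F t := [pred a | P t || (a == b t)].
rewrite (_ : [set z | _] = [set z in family F]); last first.
  by apply/setP => z; rewrite !inE.
rewrite cardsE card_family_prod -prod_nat_const [RHS]big_mkcond; apply: eq_bigr => t _.
rewrite -[t \in P]/(P t); rewrite /F; case: (P t) => /=.
  by apply: eq_card => a.
by rewrite -(card1 (b t)); apply: eq_card => a; rewrite !inE.
Qed.

Section Blowup.
Variables (T : finType) (lt : rel T) (m : nat) (w : T -> T -> nat).
Hypotheses (lt_irr : irreflexive lt) (lt_trans : transitive lt).
Hypothesis w_bound : forall x y, lt x y -> (0 < w x y <= m.+1)%N.

(** A copy of [x] carries one residue modulo [m.+1] for each vertex, so its adjacencies to copies of
    different vertices are governed by different coordinates. *)
Let row := {ffun T -> 'I_m.+1}.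

(* Whether the copies of [x] and [y] labelled [u] and [v] are joined depends only on
   [u y + v x] modulo [m.+1], so a [w x y / m.+1] fraction of the pairs is joined. *)
Definition joined (x y : T) (u v : row) := lt x y && ((u y + v x)%R < w x y)%N.

Definition blowup : {set (T * row) * (T * row)} :=
  [set h | joined h.1.1 h.2.1 h.1.2 h.2.2].

Definition transversals : {set {ffun T -> row}} :=
  [set c : {ffun T -> row} | [forall x, forall y, lt x y ==> joined x y (c x) (c y)]].

Definition through x y u v : {set {ffun T -> row}} :=
  [set c in transversals | (c x == u) && (c y == v)].

Lemma lt_asym x y : lt x y -> lt y x = false.
Proof. by move=> xy; apply/negP => yx; have := lt_trans xy yx; rewrite lt_irr. Qed.

(* Shifting the labels of the pair {z, t} by opposite amounts keeps the label sum. *)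
Lemma card_through_le x y u v u' v' :
  joined x y u v -> joined x y u' v' -> (#|through x y u v| <= #|through x y u' v'|)%N.
Proof.
move=> /andP[xy uv] /andP[_ uv'].
have xNy : (x == y) = false by apply/eqP => e; rewrite e lt_irr in xy.
have yNx : (y == x) = false by rewrite eq_sym.
pose s z t : 'I_m.+1 :=
  if z == x then u' t - u t else if z == y then v' t - v t
  else if t == x then - (u' z - u z) else if t == y then - (v' z - v z) else 0.
pose sh (c : {ffun T -> row}) : {ffun T -> row} := [ffun z => [ffun t => c z t + s z t]].
have sh_inj : injective sh.
  move=> c c' /ffunP cc'; apply/ffunP => z; apply/ffunP => t.
  by have /ffunP/(_ t) := cc' z; rewrite !ffunE => /addIr.
rewrite -(card_imset _ sh_inj); apply/subset_leq_card/subsetP => _ /imsetP[c + ->].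
rewrite !inE => /andP[/forallP cT /andP[/eqP cx /eqP cy]].
have shx : sh c x = u'.
  by apply/ffunP => t; rewrite !ffunE cx /s eqxx addrC subrK.
have shy : sh c y = v'.
  by apply/ffunP => t; rewrite !ffunE cy /s yNx eqxx addrC subrK.
rewrite shx shy !eqxx !andbT; apply/forallP => z; apply/forallP => t; apply/implyP => zt.
have /forallP/(_ t) := cT z; rewrite /joined zt implyTb !andTb => {cT}.
have zNt : (z == t) = false by apply/eqP => e; rewrite e lt_irr in zt.
have [zx|zx] := eqVneq z x.
  have [ty|ty] := eqVneq t y; first by rewrite zx ty shx shy.
  have tx : (t == x) = false by rewrite -zx eq_sym.
  rewrite !ffunE /s zx !eqxx tx (negbTE ty).
  by rewrite addrACA subrr addr0.
have [zy|zy] := eqVneq z y.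
  have [tx|tx] := eqVneq t x; first by move: zt; rewrite zy tx (lt_asym xy).
  have ty : (t == y) = false by rewrite -zy eq_sym.
  rewrite !ffunE /s zy !eqxx yNx (negbTE tx) ty.
  by rewrite addrACA subrr addr0.
rewrite !ffunE /s (negbTE zx) (negbTE zy).
have [tx|tx] := eqVneq t x; first by rewrite addrACA addNr addr0.
have [ty|ty] := eqVneq t y; first by rewrite addrACA addNr addr0.
by rewrite addrACA !addr0.
Qed.

(** For fixed [u], translating coordinate [x] of [v] by [u y] turns the condition into a bound on
    that coordinate alone, which [w x y] residues meet. *)
Lemma card_joined x y : lt x y ->
  #|[set p : row * row | joined x y p.1 p.2]| =
  (w x y * (m.+1 ^ #|T| * m.+1 ^ #|T|.-1))%N.
Proof.
move=> xy; have /andP[_ wm] := w_bound xy.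
have cu (u : row) : #|[set v : row | joined x y u v]| = (w x y * m.+1 ^ #|T|.-1)%N.
  pose sh (v : row) : row := [ffun t => v t + (if t == x then u y else 0)].
  have sh_inj : injective sh.
    move=> v v' /ffunP vv'; apply/ffunP => t.
    by have := vv' t; rewrite !ffunE => /addIr.
  rewrite -(card_imset _ sh_inj).
  pose F t := [pred a : 'I_m.+1 | (t == x) ==> (a < w x y)%N].
  rewrite (_ : sh @: _ = [set z in family F]); last first.
    apply/setP => z; rewrite [RHS]inE; apply/imsetP/familyP => [[v + ->] t|zF].
      rewrite inE => /andP[_ uv]; rewrite !inE ffunE; apply/implyP => /eqP ->.
      by rewrite eqxx addrC.
    exists [ffun t => z t - (if t == x then u y else 0)].
      rewrite inE /joined xy ffunE eqxx addrC subrK andTb.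
      by have := zF x; rewrite !inE eqxx.
    by apply/ffunP => t; rewrite !ffunE subrK.
  rewrite cardsE card_family_prod (bigD1 x)//=; congr (_ * _)%N.
    rewrite -[RHS](card_ord_ltn wm).
    by apply: eq_card => a; rewrite !inE eqxx.
  rewrite (eq_bigr (fun=> m.+1)) => [|t tx]; last first.
    by rewrite -[RHS]card_ord; apply: eq_card => a; rewrite !inE (negbTE tx).
  by rewrite prod_nat_const cardC1.
rewrite -sum1_card (eq_bigl (fun p : row * row => true && joined x y p.1 p.2)); last first.
  by move=> p; rewrite inE.
rewrite -(pair_big_dep xpredT (joined x y) (fun _ _ => 1%N)) /=.
rewrite (eq_bigr (fun=> (w x y * m.+1 ^ #|T|.-1)%N)) => [|u _].
  by rewrite sum_nat_const card_ffun card_ord mulnCA.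
by rewrite -(cu u) -sum1_card; apply: eq_bigl => v; rewrite inE.
Qed.

Let K := (m.+1 ^ #|T| * m.+1 ^ #|T|.-1)%N.

Lemma card_blowup :
  #|blowup| = (K * \sum_(q : T * T | lt q.1 q.2) w q.1 q.2)%N.
Proof.
rewrite big_distrr /= -sum1_card.
rewrite (partition_big (fun h : (T * row) * (T * row) => (h.1.1, h.2.1))
  (fun q : T * T => lt q.1 q.2)) /=; last by move=> h; rewrite inE => /andP[].
apply: eq_bigr => -[x y] /= xy; rewrite mulnC -card_joined// -sum1_card.
rewrite (reindex_onto (fun p : row * row => ((x, p.1), (y, p.2)))
  (fun h : (T * row) * (T * row) => (h.1.2, h.2.2))) /=; last first.
  by move=> [[? ?] [? ?]] /= /andP[_ /eqP[-> ->]].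
by apply: eq_bigl => -[u v]; rewrite !inE /= !eqxx !andbT.
Qed.

(** All joined pairs of copies of [x] and [y] lie in equally many transversals by [card_through_le],
    and each transversal contains exactly one of these [w x y * K] pairs. *)
Lemma card_through x y u v : joined x y u v ->
  (w x y * #|through x y u v| * K = #|transversals|)%N.
Proof.
move=> uv; have xy : lt x y by case/andP: uv.
rewrite mulnAC -card_joined// -[RHS]sum1_card.
rewrite (partition_big (fun c : {ffun T -> row} => (c x, c y))
  (fun p : row * row => p \in [set p | joined x y p.1 p.2])) /=; last first.
  by move=> c; rewrite !inE => /forallP/(_ x)/forallP/(_ y)/implyP/(_ xy).
rewrite -sum_nat_const; apply: eq_bigr => -[u' v']; rewrite inE /= => uv'.
transitivity #|through x y u' v'|.
  by apply/eqP; rewrite eqn_leq !card_through_le.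
by rewrite -sum1_card; apply: eq_bigl => c; rewrite !inE -pair_eqE.
Qed.

Lemma transversals_gt0 : (0 < #|transversals|)%N.
Proof.
apply/card_gt0P; exists [ffun _ => [ffun _ => 0]]; rewrite inE.
apply/forallP => x; apply/forallP => y; apply/implyP => xy.
by rewrite /joined xy !ffunE addr0 /=; case/andP: (w_bound xy).
Qed.

(** Double counting: each transversal [c] induces on [T] an [F]-free graph [G c], to which the
    weighted bound applies, while an edge of [H] lies in a share of the transversals inversely
    proportional to its weight, so that the weights cancel. *)
Lemma blowup_density (R : realType) (k : nat) (EF : {set 'I_k * 'I_k})
    (ltV : rel (T * row)) (g : R) :
  (forall p q, lt p.1 q.1 -> ltV p q) ->
  (forall E : {set T * T}, ograph_on lt E -> ~~ contains EF lt E ->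
     (\sum_(q in E) w q.1 q.2)%:R <= g * (\sum_(q : T * T | lt q.1 q.2) w q.1 q.2)%:R) ->
  forall H : {set (T * row) * (T * row)}, H \subset blowup ->
    ~~ contains EF ltV H -> #|H|%:R <= g * #|blowup|%:R.
Proof.
move=> ltVP dens H /subsetP HB HF.
set W := (\sum_(q : T * T | _) _)%N in dens *.
pose phi (c : {ffun T -> row}) (q : T * T) := ((q.1, c q.1), (q.2, c q.2)).
pose G c := [set q | phi c q \in H].
have phi_inj c : injective (phi c) by move=> [? ?] [? ?] [-> _ -> _].
have sumE : (K * \sum_(c in transversals) \sum_(q in G c) w q.1 q.2 =
    #|H| * #|transversals|)%N.
  transitivity (K * \sum_(c in transversals) \sum_(h in H)
      if (c h.1.1 == h.1.2) && (c h.2.1 == h.2.2) then w h.1.1 h.2.1 else 0)%N.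
    congr (_ * _)%N; apply: eq_bigr => c _; rewrite -big_mkcondr /=.
    rewrite (reindex_onto (phi c) (fun h => (h.1.1, h.2.1))) /=; last first.
      by move=> [[x u] [y v]] /= /andP[_ /andP[/eqP <- /eqP <-]].
    by apply: eq_bigl => -[x y]; rewrite inE /= !eqxx !andbT.
  rewrite exchange_big big_distrr /= -sum_nat_const; apply: eq_bigr => h hH.
  have := HB h hH; rewrite inE => /card_through <-.
  rewrite -big_mkcondr /= mulnC; congr (_ * _)%N; rewrite mulnC -sum_nat_const.
  by apply: eq_bigl => c; rewrite !inE.
have cT0 : 0 < #|transversals|%:R :> R by rewrite ltr0n transversals_gt0.
rewrite card_blowup -/W -(ler_pM2r cT0) -natrM -sumE natrM natr_sum.
apply: (@le_trans _ _ (K%:R * \sum_(c in transversals) (g * W%:R))).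
  rewrite ler_wpM2l//; apply: ler_sum => c; rewrite inE => /forallP cT; apply: dens.
    by move=> q; rewrite inE => /HB; rewrite inE => /andP[].
  apply: contra HF; apply: (contains_map (f := fun x => (x, c x))).
    by move=> x y xy; apply: ltVP.
  by move=> x y; rewrite inE.
by rewrite sumr_const natrM -[X in _ * X]mulr_natr; lra.
Qed.

End Blowup.

(** * Levels of the cube *)

Section Cube.
Variable d : nat.
Implicit Types (x y z b v : cube d) (i j t : 'I_d).

Lemma at_levelP x y i :
  reflect (x i != y i /\ forall j, (j < i)%N -> x j = y j) (at_level x y i).
Proof.
apply: (iffP andP) => -[xyi H]; split=> //.
  by move=> j ji; apply/eqP; move/forallP: H => /(_ j) /implyP; apply.
by apply/forallP => j; apply/implyP => ji; apply/eqP/H.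
Qed.

Lemma at_level_uniq x y i j : at_level x y i -> at_level x y j -> i = j.
Proof.
move=> /at_levelP[xyi Hi] /at_levelP[xyj Hj]; apply/val_inj/eqP.
case: (ltngtP i j) => // ij; first by rewrite Hj ?eqxx in xyi.
by rewrite Hi ?eqxx in xyj.
Qed.

Lemma lexltP x y :
  reflect (exists i, [/\ x i = false, y i = true & forall j, (j < i)%N -> x j = y j])
    (lexlt x y).
Proof.
apply: (iffP existsP) => [[i /andP[/at_levelP[xyi H] /negbTE xi]]|[i [xi yi H]]].
  by exists i; split=> //; move: xyi; rewrite xi; case: (y i).
by exists i; rewrite xi andbT; apply/at_levelP; rewrite xi yi.
Qed.

Lemma lexlt_at x y i : lexlt x y -> at_level x y i -> x i = false /\ y i = true.
Proof.
move=> /lexltP[j [xj yj H]] xyi; rewrite (@at_level_uniq x y i j)//.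
by apply/at_levelP; split; rewrite // xj yj.
Qed.

Lemma lexlt_irr : irreflexive (@lexlt d).
Proof. by move=> x; apply/lexltP => -[i [->]]. Qed.

Lemma lexlt_trans : transitive (@lexlt d).
Proof.
move=> y x z /lexltP[i [xi yi Hi]] /lexltP[j [yj zj Hj]]; apply/lexltP.
case: (ltngtP i j) => [ij|ji|/val_inj ij]; last by rewrite ij yj in yi.
  exists i; split=> //; first by rewrite -Hj.
  by move=> t ti; rewrite Hi// Hj// (ltn_trans ti ij).
exists j; split=> //; first by rewrite Hi.
by move=> t tj; rewrite Hi ?Hj// (ltn_trans tj ji).
Qed.

Lemma lexlt_total x y : x != y -> lexlt x y || lexlt y x.
Proof.
move=> xy; have /existsP[i0 i0P] : [exists i, x i != y i].
  apply: contraR xy; rewrite negb_exists => /forallP H; apply/eqP/ffunP => i.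
  by apply/eqP; have := H i; rewrite negbK.
case: (@arg_minnP _ i0 (fun i => x i != y i) val i0P) => i xyi imin.
have H j : (j < i)%N -> x j = y j.
  by move=> ji; apply/eqP; apply: contraTT ji => /imin; rewrite -leqNgt.
case xi : (x i); case yi : (y i); rewrite ?xi ?yi ?eqxx// in xyi.
  by apply/orP; right; apply/lexltP; exists i; split=> // j /H.
by apply/orP; left; apply/lexltP; exists i.
Qed.

(** A leaf that leaves the path of [b] at coordinate [i]; the bits of [z] up to [i] are discarded,
    which lets [z] range uniformly over the whole cube. *)
Definition branch i b z : cube d :=
  [ffun t : 'I_d => if (t < i)%N then b t else (t != i) && z t].

Lemma branch_lt i b z : b i -> lexlt (branch i b z) b.
Proof.
move=> bi; apply/lexltP; exists i; split=> //; rewrite ?ffunE ?ltnn ?eqxx//.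
by move=> j ji; rewrite ffunE ji.
Qed.

Lemma card_cube : #|{: cube d}| = (2 ^ d)%N.
Proof. by rewrite card_ffun card_bool card_ord. Qed.

(* The level-[i] pairs are the pairs [(branch i b z, b)] with [b i = 1], each
   obtained from the [2 ^ i.+1] choices of the unused first bits of [z]. *)
Lemma sum_branch (E : {set cube d * cube d}) i : ograph_on (@lexlt d) E ->
  (\sum_(b : cube d) \sum_(z : cube d) (b i && ((branch i b z, b) \in E)) = e_level E i * 2 ^ i.+1)%N.
Proof.
move=> Elt; rewrite pair_big /=.
rewrite (eq_bigr (fun p : cube d * cube d =>
  if p.1 i && ((branch i p.1 p.2, p.1) \in E) then 1 else 0)%N); last first.
  by move=> p _; case: (_ && _).
rewrite -big_mkcond /= (partition_big (fun p => (branch i p.1 p.2, p.1))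
  (fun q => q \in [set q in E | at_level q.1 q.2 i])) /=; last first.
  move=> [b z] /= /andP[bi bE]; rewrite inE bE /=; apply/at_levelP.
  by rewrite ffunE ltnn eqxx bi; split=> // j ji; rewrite ffunE ji.
rewrite /e_level -sum_nat_const; apply: eq_bigr => -[a b].
rewrite inE => /andP[abE abi]; have [/= ai bi] := lexlt_at (Elt _ abE) abi.
case/at_levelP: abi => /= _ ab.
have := card_agree (fun t : 'I_d => (t < i.+1)%N) a.
rewrite card_bool (@card_ord_ltn d) // => <-; rewrite -sum1_card.
rewrite (reindex_onto (fun z => (b, z)) snd) /=; last first.
  by move=> [b' z] /= /andP[_ /eqP[_ ->]].
apply: eq_bigl => z; rewrite inE eqxx andbT bi /=; apply/andP/forallP => [[_ /eqP[<-]] t|H].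
  by rewrite ltnS ffunE -val_eqE; case: ltngtP => //=.
have -> : branch i b z = a.
  apply/ffunP => t; rewrite ffunE; have := H t; rewrite ltnS.
  rewrite -val_eqE; case: ltngtP => [/ab //|it /= /eqP ->|] //=.
  by move=> /val_inj -> _; rewrite ai.
by rewrite abE !eqxx.
Qed.

Lemma card_bit i : #|[set b : cube d | b i]| = (2 ^ d.-1)%N.
Proof.
have := card_agree (fun t => t != i) [ffun=> true].
rewrite card_bool (_ : #|(fun t => t != i)| = d.-1) => [<-|]; last first.
  by rewrite -[in RHS](card_ord d) -(cardC1 i); apply: eq_card.
apply: eq_card => b; rewrite !inE; apply/idP/forallP => [bi t|/(_ i)].
  by rewrite ffunE eqb_id; case: eqP => // ->.
by rewrite eqxx ffunE eqb_id.
Qed.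

(** The right-hand side counts the pairs of a [b] with [b i] and an arbitrary [z]; it does not
    depend on the level. *)
Lemma tau_branch i : (tau i.+1 d * 2 ^ i.+1 = 2 ^ d * 2 ^ d.-1)%N.
Proof. by rewrite /tau -!expnD; congr (2 ^ _)%N; have := ltn_ord i; lia. Qed.

Definition all_pairs : {set cube d * cube d} := [set q | lexlt q.1 q.2].

Lemma e_level_all_pairs i : e_level all_pairs i = tau i.+1 d.
Proof.
apply/eqP; rewrite -(eqn_pmul2r (expn_gt0 2 i.+1)) tau_branch -sum_branch; last first.
  by move=> q; rewrite inE.
rewrite (eq_bigr (fun b => if b i then 2 ^ d else 0)%N) => [|b _].
  rewrite -big_mkcond sum_nat_const mulnC /=; apply/eqP; congr (_ * _)%N.
  by rewrite -(card_bit i) cardsE.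
rewrite (eq_bigr (fun=> (b i : nat))) => [|z _].
  by rewrite sum_nat_const card_cube; case: (b i); rewrite ?muln1 ?muln0.
by case bi : (b i) => //=; rewrite inE branch_lt.
Qed.

Lemma e_level_le (E : {set cube d * cube d}) i :
  ograph_on (@lexlt d) E -> (e_level E i <= tau i.+1 d)%N.
Proof.
move=> Elt; rewrite -e_level_all_pairs; apply/subset_leq_card/subsetP => q.
by rewrite !inE => /andP[/Elt -> ->].
Qed.

(* Inversely proportional to [tau i.+1 d] on the level-[i] pairs. *)
Definition level_weight x y : nat := (\sum_(i < d) at_level x y i * 2 ^ i)%N.

Lemma level_weightE x y i : at_level x y i -> level_weight x y = (2 ^ i)%N.
Proof.
move=> xyi; rewrite /level_weight (bigD1 i)//= xyi mul1n big1 ?addn0// => j ji.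
case xyj : (at_level x y j) => //; by rewrite (at_level_uniq xyi xyj) eqxx in ji.
Qed.

Lemma level_weight_bound x y : lexlt x y -> (0 < level_weight x y <= (2 ^ d).-1.+1)%N.
Proof.
move=> /existsP[i /andP[/level_weightE -> _]].
by rewrite expn_gt0 /= prednK ?expn_gt0// leq_exp2l// ltnW.
Qed.

Lemma sum_level_weight (E : {set cube d * cube d}) :
  (\sum_(q in E) level_weight q.1 q.2 = \sum_(i < d) e_level E i * 2 ^ i)%N.
Proof.
rewrite exchange_big; apply: eq_bigr => i _ /=.
rewrite -big_distrl /=; congr (_ * _)%N; rewrite /e_level -sum1_card.
rewrite [RHS](eq_bigl (fun q => (q \in E) && at_level q.1 q.2 i)); last first.
  by move=> q; rewrite inE.
by rewrite big_mkcondr; apply: eq_bigr => q _; case: at_level.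
Qed.

Lemma sum_level_weight_all :
  (2 * \sum_(q : cube d * cube d | lexlt q.1 q.2) level_weight q.1 q.2 =
   d * (2 ^ d * 2 ^ d.-1))%N.
Proof.
rewrite (eq_bigl (fun q => q \in all_pairs)); last by move=> q; rewrite inE.
rewrite sum_level_weight big_distrr /=.
have := sum_nat_const 'I_d (2 ^ d * 2 ^ d.-1)%N; rewrite card_ord => <-.
by apply: eq_bigr => i _; rewrite e_level_all_pairs -(tau_branch i) expnS mulnCA.
Qed.

(** A rich level contributes at most the full weight of a level, any other at most [alpha] times it,
    and fewer than [C] levels are rich. *)
Lemma not_rich_weight (R : realType) (alpha : R) (C : nat) (E : {set cube d * cube d}) :
  0 <= alpha -> ograph_on (@lexlt d) E -> ~ rich alpha C E ->
  2 * (\sum_(q in E) level_weight q.1 q.2)%:R <=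
    (C%:R + alpha * d%:R) * (2 ^ d * 2 ^ d.-1)%:R.
Proof.
move=> a0 Elt /negP; rewrite -ltnNge => richC.
set N := (2 ^ d * 2 ^ d.-1)%N.
rewrite sum_level_weight natr_sum mulr_sumr.
apply: (@le_trans _ _ (\sum_(i < d) ((if rich_level alpha E i then 1 else 0) + alpha) * N%:R)).
  apply: ler_sum => i _; rewrite -natrM mulnCA -expnS /N -(tau_branch i).
  rewrite !natrM mulrA ler_wpM2r//; case: ifPn => [_|].
    have := e_level_le i Elt; rewrite -(ler_nat R) => /le_trans; apply.
    by rewrite ler_peMl// lerDl.
  by rewrite /rich_level -ltNge add0r => /ltW.
rewrite -mulr_suml ler_wpM2r// big_split /= sumr_const card_ord mulr_natr lerD2r.
rewrite -big_mkcond /= sumr_const ler_nat.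
by apply: leq_trans (ltnW richC); rewrite cardsE.
Qed.

End Cube.

(** * Upper bound *)

Section LexPair.
Variables (T U : finType) (lt : rel T).
Hypotheses (lt_irr : irreflexive lt) (lt_trans : transitive lt).
Hypothesis lt_total : forall x y, x != y -> lt x y || lt y x.

(** Edges of the blow-up never join two copies of one vertex, so the order among these copies may
    come from the enumeration of [U]. *)
Definition lexpair : rel (T * U) := fun p q =>
  lt p.1 q.1 || (p.1 == q.1) && (enum_rank p.2 < enum_rank q.2)%N.

Lemma lexpair_irr : irreflexive lexpair.
Proof. by move=> p; rewrite /lexpair lt_irr ltnn andbF. Qed.

Lemma lexpair_trans : transitive lexpair.
Proof.
move=> q p r /orP[pq|/andP[/eqP pq pq2]] /orP[qr|/andP[/eqP qr qr2]]; apply/orP.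
- by left; exact: lt_trans pq qr.
- by left; rewrite -qr.
- by left; rewrite pq.
- by right; rewrite pq qr eqxx (ltn_trans pq2 qr2).
Qed.

Lemma lexpair_total p q : p != q -> lexpair p q || lexpair q p.
Proof.
rewrite /lexpair; case: p q => [x u] [y v] /=; case: (eqVneq x y) => [->|xy _].
  move=> uv; rewrite lt_irr /= -neq_ltn; apply: contra_neq uv.
  by move=> /val_inj/enum_rank_inj ->.
by have /orP[->|->] := lt_total xy; rewrite ?orbT.
Qed.

End LexPair.

Lemma has_lbound_rho (R : realType) (k : nat) (EF : {set 'I_k * 'I_k}) :
  has_lbound [set x : R | exists (n : nat) (EG : {set 'I_n * 'I_n}),
        ograph_on (@ord_lt n) EG /\ (0 < #|EG|)%N /\ x = rho_FG R EF EG]%classic.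
Proof. by exists 0 => _ [n [EG [_ [_ ->]]]]; exact: rho_FG_ge0. Qed.

Lemma rho_F_le (R : realType) (k : nat) (EF : {set 'I_k * 'I_k}) (alpha : R) (C : nat) :
  0 <= alpha ->
  (forall (d : nat) (E : {set cube d * cube d}),
     ograph_on (@lexlt d) E -> rich alpha C E -> contains EF (@lexlt d) E) ->
  rho_F R EF <= alpha.
Proof.
move=> a0 H; apply/ler_addgt0Pr => e e0.
(* Large enough for the error [C / d] to be at most [e]. *)
pose d := (Num.bound (C%:R / e)).+1.
have Cd : C%:R <= e * d%:R.
  rewrite mulrC -ler_pdivrMr//; apply: ltW.
  apply: (@lt_trans _ _ (Num.bound (C%:R / e))%:R); last by rewrite ltr_nat.
  by apply: archi_boundP; rewrite divr_ge0// ltW.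
pose B := blowup (@lexlt d) (2 ^ d).-1 (@level_weight d).
have N0 : (0 < 2 ^ d * 2 ^ d.-1)%N by rewrite muln_gt0 !expn_gt0.
have B0 : (0 < #|B|)%N.
  rewrite card_blowup//; last exact: level_weight_bound.
  rewrite !muln_gt0 !expn_gt0 /= -(ltn_pmul2l (isT : (0 < 2)%N)) muln0.
  by rewrite sum_level_weight_all muln_gt0.
have ae0 : 0 <= alpha + e by rewrite addr_ge0// ltW.
have [n [EG [EGo EG0 EGle]]] : exists (n : nat) (EG : {set 'I_n * 'I_n}),
    [/\ ograph_on (@ord_lt n) EG, (0 < #|EG|)%N & rho_FG R EF EG <= alpha + e].
  apply: (ograph_to_ord (lexpair_irr (U := _) (@lexlt_irr d)) (lexpair_trans (@lexlt_trans d))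
    (lexpair_total (@lexlt_irr d) (@lexlt_total d)) (E := B)) => //.
    by move=> [p q]; rewrite inE => /andP[/= pq _]; apply/orP; left.
  apply: (blowup_density (@lexlt_irr d) (@lexlt_trans d) (@level_weight_bound d)).
    by move=> p q pq; apply/orP; left.
  move=> E Elt EF'; have nr : ~ rich alpha C E.
    by move=> /(H _ _ Elt); apply/negP.
  rewrite -(ler_pM2l (ltr0Sn R 1)); apply: le_trans (not_rich_weight a0 Elt nr) _.
  rewrite [leRHS]mulrCA -natrM sum_level_weight_all [in leRHS]natrM mulrA ler_wpM2r// mulrDl.
  by rewrite addrC lerD2l.
apply: le_trans EGle; apply: ge_inf; first exact: has_lbound_rho.
by exists n, EG.
Qed.

(** * Random combs *)

(** Two distinct coordinates of a uniform [z] are independent and uniform: the involution [sw]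
    exchanges them with an auxiliary pair. *)
Lemma sum_two_coords (I X : finType) (i j : I) (g : X -> X -> nat) : i != j ->
  ((\sum_(z : {ffun I -> X}) g (z i) (z j)) * #|X| ^ 2 =
   #|X| ^ #|I| * \sum_x \sum_y g x y)%N.
Proof.
move=> ij; have ji : (j == i) = false by rewrite eq_sym (negbTE ij).
pose sw (p : {ffun I -> X} * (X * X)) : {ffun I -> X} * (X * X) :=
  ([ffun t => if t == i then p.2.1 else if t == j then p.2.2 else p.1 t],
   (p.1 i, p.1 j)).
have swK : involutive sw.
  move=> [z [x y]]; rewrite /sw /= !ffunE !eqxx ji; congr pair.
  by apply/ffunP => t; rewrite !ffunE; case: eqP => [->|_] //; case: eqP => [->|].
transitivity (\sum_(p : {ffun I -> X} * (X * X)) g (p.1 i) (p.1 j))%N.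
  rewrite -(pair_bigA _ (fun (z : {ffun I -> X}) (q : X * X) => g (z i) (z j))) big_distrl /=.
  by apply: eq_bigr => z _; rewrite sum_nat_const card_prod mulnC expnS expn1.
rewrite (reindex_inj (can_inj swK)) /=.
transitivity (\sum_(z : {ffun I -> X}) \sum_(q : X * X) g q.1 q.2)%N.
  rewrite pair_bigA; apply: eq_bigr => p _ /=.
  by rewrite !ffunE !eqxx ji.
by rewrite sum_nat_const card_ffun pair_bigA.
Qed.

Section Mix.
Variable d : nat.

Definition mix (i : 'I_d) (v y : cube d) : cube d :=
  [ffun t : 'I_d => if (t < i)%N then v t else y t].

(** Splicing two independent uniform points at [i] gives a uniform point, because forming both
    splices at once is an involution on pairs. *)
Lemma sum_mix i (g : cube d -> nat) :
  (\sum_v \sum_y g (mix i v y) = 2 ^ d * \sum_u g u)%N.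
Proof.
rewrite pair_bigA /=.
pose sw (p : cube d * cube d) := (mix i p.1 p.2, mix i p.2 p.1).
have swK : involutive sw.
  by move=> [v y]; congr pair; apply/ffunP => t; rewrite !ffunE /=; case: ltnP.
rewrite (reindex_inj (can_inj swK)) /=.
rewrite (eq_bigr (fun p : cube d * cube d => g p.1)) => [|p _]; last first.
  by congr (g _); apply/ffunP => t; rewrite !ffunE; case: ltnP.
rewrite -(pair_bigA _ (fun u (_ : cube d) => g u)) /= big_distrr /=.
by apply: eq_bigr => u _; rewrite sum_nat_const card_cube.
Qed.

End Mix.

(** * Second moment of the bits in one block *)

Section Typical.
Variables (R : realType) (d B : nat) (s : 'I_B -> 'I_d).
Hypothesis s_inj : injective s.

Definition hits (b : cube d) (c : bool) := #|[pred k | b (s k) == c]|.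

Let S (b : cube d) : R := \sum_k (-1) ^+ b (s k).

Lemma bit_sum b : S b = (hits b false)%:R - (hits b true)%:R.
Proof.
rewrite /S /hits (bigID (fun k => b (s k))) /= addrC; congr (_ + _).
  rewrite -sumr_const; apply: eq_big => [k|k /negbTE -> //].
  by rewrite inE eqbF_neg.
by rewrite -sumr_const -sumrN; apply: eq_big => [k|k ->//]; rewrite inE eqb_id.
Qed.

Lemma hitsD b : (hits b false + hits b true = B)%N.
Proof.
rewrite -[RHS](card_ord B) -(cardC [pred k | b (s k) == false]); congr (_ + _)%N.
by apply: eq_card => k; rewrite !inE eqbF_neg negbK eqb_id.
Qed.

(** The off-diagonal terms cancel, since flipping the bit at [s k] permutes the cube and negates the
    product; each diagonal term is 1. *)
Lemma sum_sqr_bit_sum : \sum_b S b ^+ 2 = B%:R * 2 ^+ d.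
Proof.
transitivity (\sum_k \sum_k' \sum_(b : cube d) (-1) ^+ b (s k) * (-1) ^+ b (s k') : R).
  rewrite (eq_bigr (fun b : cube d => \sum_k \sum_k' (-1) ^+ b (s k) * (-1) ^+ b (s k'))).
    by rewrite exchange_big; apply: eq_bigr => k _; rewrite exchange_big.
  by move=> b _; rewrite expr2 /S big_distrlr.
rewrite (eq_bigr (fun=> 2 ^+ d)) => [|k _].
  by rewrite sumr_const card_ord mulr_natl.
rewrite (bigD1 k) //= [X in _ + X]big1 ?addr0 => [|k' kk'].
  rewrite (eq_bigr (fun=> 1)) => [|b _]; last by  rewrite -expr2 sqrr_sign.
  by rewrite sumr_const card_cube natrX.
set X := \sum_(b : cube d) _.
pose flip (b : cube d) : cube d := [ffun t => (t == s k) (+) b t].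
have flipK : involutive flip.
  by move=> b; apply/ffunP => t; rewrite !ffunE addbA addbb.
have : X = - X.
  rewrite {1}/X (reindex_inj (can_inj flipK)) -sumrN; apply: eq_bigr => b _.
  rewrite !ffunE eqxx (inj_eq s_inj) (negbTE kk') addTb addFb signrN mulNr//.
by move=> XX; lra.
Qed.

Definition balanced (eta : R) b : bool :=
  [forall c : bool, (1 - eta) * B%:R <= 2 * (hits b c)%:R].

(** Chebyshev's inequality: where one bit value is too rare, [S b] has absolute value at least
    [eta * B]. *)
Lemma card_unbalanced eta : 0 <= eta -> (0 < B)%N ->
  #|[pred b | ~~ balanced eta b]|%:R * (eta ^+ 2 * B%:R) <= 2 ^+ d.
Proof.
move=> eta0 B0; have B0' : 0 < B%:R :> R by rewrite ltr0n.
rewrite -(ler_pM2l B0') -sum_sqr_bit_sum.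
have -> : B%:R * (#|[pred b | ~~ balanced eta b]|%:R * (eta ^+ 2 * B%:R)) =
    \sum_(b | ~~ balanced eta b) (eta * B%:R) ^+ 2 :> R.
  by rewrite sumr_const -[RHS]mulr_natl; ring.
rewrite [leRHS](bigID (fun b => ~~ balanced eta b)) /= -[leLHS]addr0 lerD//; last first.
  by rewrite sumr_ge0// => b _; exact: sqr_ge0.
apply: ler_sum => b; rewrite /balanced negb_forall => /existsP[c]; rewrite -ltNge => hc.
have : (hits b false)%:R + (hits b true)%:R = B%:R :> R by rewrite -natrD hitsD.
have etaB : 0 <= eta * B%:R by rewrite mulr_ge0 // ltW.
rewrite bit_sum; case: c hc => hc hs; last rewrite -[leRHS]sqrrN opprB.
  by rewrite ler_sqr ?nnegrE//; lra.
by rewrite ler_sqr ?nnegrE//; lra.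
Qed.

End Typical.

(** * Edges spanned by a random comb *)

Section Comb.
Variables (R : realType) (d n B : nat) (r : 'I_n -> 'I_B -> 'I_d).
Hypothesis r_lt : forall (t t' : 'I_n) (b b' : 'I_B), (t < t')%N -> (r t b < r t' b')%N.
Hypothesis r_inj : forall t, injective (r t).
Variable E : {set cube d * cube d}.
Hypothesis Elt : ograph_on (@lexlt d) E.
Implicit Types (lam : {ffun 'I_n -> 'I_B}) (b u v x y : cube d).

(** [r t] lists the levels of block [t]; [lam] is the random choice of one level in each block. *)
Definition lev lam t := r t (lam t).

Lemma lev_lt lam t t' : (lev lam t < lev lam t')%N = (t < t')%N.
Proof.
apply/idP/idP => [|tt']; last exact: r_lt.
apply: contraTT; rewrite -!leqNgt leq_eqVlt => /orP[/eqP/val_inj ->//|t't].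
exact/ltnW/r_lt.
Qed.

Lemma lev_inj lam : injective (lev lam).
Proof.
move=> t t' tt'; apply/val_inj/eqP.
by case: (ltngtP t t') => //; rewrite -(lev_lt lam) tt' ltnn.
Qed.

Definition spine lam v : cube d := [ffun p => [exists t : 'I_n, lev lam t == p] || v p].

(* The leaves of a random comb: [comb lam v z t] leaves the path of [spine lam v]
   at level [lev lam t], where that path turns right. *)
Definition comb lam v (z : {ffun 'I_n -> cube d}) t : cube d :=
  branch (lev lam t) (spine lam v) (z t).

(** By [combE], a leaf is a uniform point [u] with its bits overwritten at the selected levels up to
    [lev lam t]: by 1 before the last, by 0 at the last. *)
Definition tooth lam t u : cube d :=
  [ffun p => if p == lev lam t then false
             else [exists t' : 'I_n, (t' < t)%N && (lev lam t' == p)] || u p].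

Lemma combE lam v z t : comb lam v z t = tooth lam t (mix (lev lam t) v (z t)).
Proof.
apply/ffunP => p; rewrite !ffunE; case: (eqVneq p (lev lam t)) => [->|pt].
  by rewrite ltnn.
case: ltnP => [plt|].
  congr (_ || _); apply/existsP/existsP => -[t' ht']; exists t'; last by case/andP: ht'.
  by rewrite ht' andbT -(lev_lt lam) (eqP ht').
move=> ple; rewrite orb_idl// => /existsP[t' /andP[tt' /eqP pt']].
by rewrite -(lev_lt lam) pt' ltnNge ple in tt'.
Qed.

(** Before [lev lam i] both leaves follow the spine, so the pair has the shape counted by
    [sum_branch]. *)
Lemma comb_branch lam v z (i j : 'I_n) : (i < j)%N ->
  comb lam v z i = branch (lev lam i) (comb lam v z j) (z i).
Proof.
move=> ij; apply/ffunP => p; rewrite !ffunE; case: ifP => // pi.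
by rewrite (ltn_trans pi) ?lev_lt.
Qed.

Lemma comb_lt lam v z (i j : 'I_n) : (i < j)%N -> lexlt (comb lam v z i) (comb lam v z j).
Proof.
move=> ij; rewrite (comb_branch _ _ _ ij); apply: branch_lt.
rewrite ffunE lev_lt ij ffunE; apply/orP; left; apply/existsP; by exists i.
Qed.

Definition forced lam (j : 'I_n) b : bool :=
  [forall t : 'I_n, (t <= j)%N ==> (b (lev lam t) == (t != j))].

Lemma tooth_forced lam j u : forced lam j (tooth lam j u).
Proof.
apply/forallP => t; apply/implyP => tj; rewrite ffunE (inj_eq (@lev_inj lam)).
case: (eqVneq t j) => [_|tNj] //=.
rewrite eqb_id; apply/orP; left; apply/existsP; exists t.
by rewrite eqxx andbT ltn_neqAle tj andbT.
Qed.

(** [tooth lam j] forgets exactly the [j.+1] bits that it prescribes (indices start at 0), so each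
    forced [b] has [2 ^ j.+1] preimages. *)
Lemma sum_tooth lam j (h : cube d -> nat) :
  (\sum_u h (tooth lam j u) = 2 ^ j.+1 * \sum_(b | forced lam j b) h b)%N.
Proof.
rewrite (partition_big (tooth lam j) (forced lam j)) /= => [|u _]; last exact: tooth_forced.
rewrite big_distrr /=; apply: eq_bigr => b bf.
rewrite (eq_bigr (fun=> h b)) => [|u /eqP -> //]; rewrite sum_nat_const; congr (_ * _)%N.
pose P := [pred p | [exists t : 'I_n, (t <= j)%N && (lev lam t == p)]].
have <- : #|P| = j.+1.
  rewrite -(card_ord_ltn (ltn_ord j)) -(card_imset _ (@lev_inj lam)).
  apply: eq_card => p; rewrite !inE; apply/existsP/imsetP => [[t /andP[tj /eqP <-]]|[t tj ->]].
    by exists t.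
  by exists t; rewrite eqxx andbT.
rewrite -card_bool -(card_agree P b); apply: eq_card => u; rewrite [RHS]inE -[LHS]/(tooth lam j u == b).
have bE (t : 'I_n) : (t <= j)%N -> b (lev lam t) = (t != j).
  by move=> tj; move/forallP: bf => /(_ t)/implyP/(_ tj)/eqP.
apply/eqP/forallP => [ub p|H].
  rewrite -implyNb; apply/implyP; rewrite negb_exists => /forallP Pp.
  apply/eqP; rewrite -ub ffunE; case: (eqVneq p (lev lam j)) => [pj|pj].
    by have := Pp j; rewrite pj eqxx leqnn.
  rewrite orb_idl// => /existsP[t /andP[tj tp]]; have := Pp t.
  by rewrite tp (ltnW tj).
apply/ffunP => p; rewrite ffunE; case: eqVneq => [->|pj]; first by rewrite bE ?eqxx.
case: existsP => [[t /andP[tj /eqP <-]]|Np] /=.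
  by rewrite bE ?(ltnW tj)//; apply/esym; apply: contraTneq tj => ->; rewrite ltnn.
have /orP[/existsP[t /andP[]]|/eqP ->//] := H p.
rewrite leq_eqVlt => /orP[/eqP/val_inj -> /eqP jp|tj tp]; first by rewrite -jp eqxx in pj.
by case: Np; exists t; rewrite tj.
Qed.

(** The inner sum of [sum_branch]: over all [b] it adds up to a multiple of [e_level E i]. *)
Definition below i b := (\sum_(x : cube d) (b i && ((branch i b x, b) \in E)))%N.

(** Given [lam], leaf [j] is [tooth] of a uniform point and leaf [i] branches off it with an
    independent uniform [z i]; the remaining randomness only contributes powers of [2 ^ d]. *)
Lemma sum_comb lam (i j : 'I_n) : (i < j)%N ->
  ((\sum_v \sum_z ((comb lam v z i, comb lam v z j) \in E)) * (2 ^ d) ^ 2 =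
   (2 ^ d) ^ n.+1 * (2 ^ j.+1 * \sum_(b | forced lam j b) below (lev lam i) b))%N.
Proof.
move=> ij; have iNj : i != j by apply: contraTneq ij => ->; rewrite ltnn.
rewrite -card_cube big_distrl /=.
pose g v x y : nat := let b := tooth lam j (mix (lev lam j) v y) in
  (branch (lev lam i) b x, b) \in E.
have gE v (z : {ffun 'I_n -> cube d}) :
    ((comb lam v z i, comb lam v z j) \in E) = g v (z i) (z j) :> nat.
  by rewrite (comb_branch _ _ _ ij) combE.
under eq_bigr => v _.
  rewrite (eq_bigr _ (fun z _ => gE v z)) (sum_two_coords (g v) iNj) card_ord.
  over.
rewrite -big_distrr /= expnSr -mulnA; congr (_ * _)%N.
under eq_bigr => v _ do rewrite exchange_big /=.
pose f u := (\sum_x ((branch (lev lam i) (tooth lam j u) x, tooth lam j u) \in E))%N.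
rewrite (sum_mix (lev lam j) f) card_cube; congr (_ * _)%N.
rewrite (sum_tooth lam j (fun b => \sum_x ((branch (lev lam i) b x, b) \in E))%N).
congr (_ * _)%N; apply: eq_bigr => b /forallP/(_ i)/implyP/(_ (ltnW ij)) /eqP bi.
by apply: eq_bigr => x _; rewrite bi iNj.
Qed.

Variables (alpha eta : R).
Hypotheses (eta0 : 0 <= eta) (eta1 : eta <= 1) (B0 : (0 < B)%N).

Definition typical b : bool := [forall t, balanced (r t) eta b].

(** The blocks choose independently. A block [t <= j] other than [i] must hit a prescribed bit and,
    [b] being balanced there, has at least [(1 - eta) * B / 2] choices; later blocks are free. One
    factor 2 goes to each [t <= j], and that of block [i] remains on the left. *)
Lemma card_forced (i j : 'I_n) (k : 'I_B) b : (i < j)%N -> typical b -> b (r i k) ->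
  2 * ((1 - eta) * B%:R) ^+ n.-1 <=
  2 ^+ j.+1 * #|[pred lam : {ffun 'I_n -> 'I_B} | (lam i == k) && forced lam j b]|%:R :> R.
Proof.
move=> ij /forallP btyp bik.
have eB : 0 <= (1 - eta) * B%:R by rewrite mulr_ge0// subr_ge0.
pose F t : {set 'I_B} :=
  [set k' | ((t == i) ==> (k' == k)) && ((t <= j)%N ==> (b (r t k') == (t != j)))].
have -> : #|[pred lam : {ffun 'I_n -> 'I_B} | (lam i == k) && forced lam j b]| = #|family (fun t => mem (F t))|.
  apply: eq_card => lam; rewrite !inE; apply/andP/familyP => [[/eqP lamk /forallP lf] t|lf].
    by rewrite !inE lf andbT; apply/implyP => /eqP ->; rewrite lamk.
  split; first by have := lf i; rewrite !inE eqxx => /andP[].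
  by apply/forallP => t; have := lf t; rewrite !inE => /andP[].
rewrite card_family_prod natr_prod.
have -> : 2 ^+ j.+1 = \prod_(t < n) (if (t <= j)%N then 2 else 1) :> R.
  by rewrite -big_mkcond /= prodr_const (card_ord_ltn (ltn_ord j)).
rewrite -big_split /= (bigD1 i)// (ltnW ij); apply: ler_pM => //.
- exact: exprn_ge0.
- rewrite ler_peMr// ler1n; apply/card_gt0P; exists k.
  by rewrite !inE !eqxx (ltnW ij) bik -(inj_eq val_inj) (ltn_eqF ij).
- have -> : n.-1 = #|[pred t | t != i]| by rewrite -[in LHS](card_ord n) -(cardC1 i).
  rewrite -prodr_const; apply: ler_prod => t /= ti; rewrite eB /=.
  case: ifPn => tj.
    have /forallP/(_ (t != j)) := btyp t; rewrite /hits.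
    rewrite (eq_card (B := F t))// => k'.
    by rewrite !inE (negbTE ti) tj.
  rewrite mul1r (_ : #|F t| = B); first by rewrite ler_piMl// gerBl.
  by rewrite -[RHS]card_ord; apply: eq_card => k'; rewrite !inE (negbTE ti) (negbTE tj).
Qed.

Lemma card_atypical :
  #|[pred b | ~~ typical b]|%:R * (eta ^+ 2 * B%:R) <= n%:R * 2 ^+ d :> R.
Proof.
have le : #|[pred b | ~~ typical b]|%:R <=
    \sum_t #|[pred b | ~~ balanced (r t) eta b]|%:R :> R.
  rewrite -natr_sum ler_nat -[leqLHS]sum1_card big_mkcond /=.
  rewrite (eq_bigr (fun t => \sum_(b : cube d) ~~ balanced (r t) eta b)%N) => [|t _]; last first.
    by rewrite -sum1_card big_mkcond; apply: eq_bigr => b _; rewrite inE; case: balanced.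
  rewrite exchange_big /=; apply: leq_sum => b _; rewrite inE.
  case: ifP => //; rewrite negb_forall => /existsP[t bt].
  by rewrite (bigD1 t)//= bt.
apply: (@le_trans _ _ (\sum_(t < n) 2 ^+ d)); last by rewrite sumr_const card_ord mulr_natl.
apply: (le_trans (ler_wpM2r _ le)); first by rewrite mulr_ge0 ?sqr_ge0.
by rewrite mulr_suml; apply: ler_sum => t _; exact: card_unbalanced.
Qed.

Hypothesis rich_r : forall t k, rich_level alpha E (r t k).

(** Richness bounds the sum over all [b] from below; each atypical [b] costs at most [2 ^ d], and
    [card_atypical] bounds their number. *)
Lemma sum_below_typical t k :
  2 * (\sum_(b | typical b) below (r t k) b)%:R * (eta ^+ 2 * B%:R) >=
  (alpha * (eta ^+ 2 * B%:R) - 2 * n%:R) * (2 ^+ d) ^+ 2 :> R.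
Proof.
have eB : 0 <= eta ^+ 2 * B%:R by rewrite mulr_ge0 ?sqr_ge0.
have d0 : (0 < d)%N by apply: leq_ltn_trans (ltn_ord (r t k)).
have dS : 2 ^+ d = 2 * 2 ^+ d.-1 :> R by rewrite -exprS prednK.
have : alpha * (2 ^+ d * 2 ^+ d.-1) <= (\sum_b below (r t k) b)%:R.
  have := rich_r t k; rewrite /rich_level (sum_branch _ Elt) natrM.
  rewrite -(@ler_pM2r _ (2 ^ (r t k).+1)%:R) ?ltr0n ?expn_gt0//; apply: le_trans.
  by rewrite -[leRHS]mulrA -[X in _ <= _ * X]natrM tau_branch natrM !natrX.
rewrite (bigID typical) /= natrD.
have : (\sum_(b | ~~ typical b) below (r t k) b)%:R <= 2 ^+ d * #|[pred b | ~~ typical b]|%:R :> R.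
  rewrite mulrC -natrX -natrM ler_nat -sum_nat_const; apply: leq_sum => b _.
  rewrite -card_cube -sum1_card; apply: leq_sum => x _; exact: leq_b1.
have := card_atypical.
set S1 := (\sum_(b | typical b) _)%N; set S2 := (\sum_(b | _) _)%N; set A := #|_|.
move=> hA hS2 hS.
have h1 : alpha * (2 ^+ d * 2 ^+ d.-1) - 2 ^+ d * A%:R <= S1%:R by lra.
have := ler_wpM2r eB h1; have D0 : 0 <= 2 ^+ d :> R by exact: exprn_ge0.
have := ler_wpM2l D0 hA; rewrite dS; set e := 2 ^+ d.-1; set q := eta ^+ 2 * _; lra.
Qed.

(** For typical [b], [card_forced] shows that a random [lam] makes [b] forced almost as often as
    unbiased bits would; the loss is the factor [(1 - eta) ^+ n.-1]. *)
Lemma sum_all_combs (i j : 'I_n) : (i < j)%N ->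
  (1 - eta) ^+ n.-1 * (alpha * (eta ^+ 2 * B%:R) - 2 * n%:R) *
    (B%:R ^+ n * (2 ^+ d) ^+ n.+1) <=
  (\sum_lam \sum_v \sum_z ((comb lam v z i, comb lam v z j) \in E))%:R *
    (eta ^+ 2 * B%:R) :> R.
Proof.
move=> ij; set S := (\sum_lam _)%N.
have n0 : (0 < n)%N by apply: leq_ltn_trans (ltn_ord i).
have D0 : 0 < 2 ^+ d :> R by exact: exprn_gt0.
have q0 : 0 <= eta ^+ 2 * B%:R by rewrite mulr_ge0 ?sqr_ge0.
have SE : (S * (2 ^ d) ^ 2 = (2 ^ d) ^ n.+1 * (2 ^ j.+1 *
    \sum_k \sum_b #|[pred lam : {ffun 'I_n -> 'I_B} | (lam i == k) && forced lam j b]| * below (r i k) b))%N.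
  rewrite /S big_distrl /=.
  rewrite (eq_bigr _ (fun lam _ => sum_comb lam ij)) -big_distrr -big_distrr /=.
  congr (_ * (_ * _))%N; rewrite (partition_big (fun lam => lam i) predT)//=.
  apply: eq_bigr => k _; rewrite (exchange_big_dep predT) //=; apply: eq_bigr => b _.
  rewrite -sum_nat_const; apply: eq_big => [lam|lam /andP[/eqP lamk _]]; first by rewrite inE.
  by rewrite /lev lamk.
have main : (1 - eta) ^+ n.-1 * (alpha * (eta ^+ 2 * B%:R) - 2 * n%:R) *
    (B%:R ^+ n * (2 ^+ d) ^+ 2) <= (2 ^ j.+1 *
    \sum_k \sum_b #|[pred lam : {ffun 'I_n -> 'I_B} | (lam i == k) && forced lam j b]| * below (r i k) b)%N%:R
    * (eta ^+ 2 * B%:R) :> R.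
  rewrite natrM natr_sum mulr_sumr mulr_suml.
  have -> : (1 - eta) ^+ n.-1 * (alpha * (eta ^+ 2 * B%:R) - 2 * n%:R) *
    (B%:R ^+ n * (2 ^+ d) ^+ 2) = \sum_(k < B) ((1 - eta) * B%:R) ^+ n.-1 *
     ((alpha * (eta ^+ 2 * B%:R) - 2 * n%:R) * (2 ^+ d) ^+ 2).
    have BS : B%:R ^+ n = B%:R * B%:R ^+ n.-1 :> R by rewrite -exprS prednK.
    by rewrite sumr_const card_ord -[RHS]mulr_natr exprMn BS; ring.
  apply: ler_sum => k _.
  have eB : 0 <= ((1 - eta) * B%:R) ^+ n.-1 by rewrite exprn_ge0// mulr_ge0// subr_ge0.
  apply: (le_trans (ler_wpM2l eB (sum_below_typical i k))).
  rewrite [leLHS]mulrA ler_wpM2r// mulrCA mulrA natr_sum mulr_sumr [in leRHS]natr_sum mulr_sumr.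
  rewrite big_mkcond /=; apply: ler_sum => b _; case: ifPn => [bt|_]; last first.
    by rewrite mulr_ge0// exprn_ge0.
  rewrite natrM mulrA; case bik : (b (r i k)).
    by rewrite ler_wpM2r// natrX card_forced.
  rewrite /below big1 ?mulr0// => x _; by rewrite bik.
rewrite -(ler_pM2r (exprn_gt0 2 D0)).
have -> : S%:R * (eta ^+ 2 * B%:R) * (2 ^+ d) ^+ 2 = (S * (2 ^ d) ^ 2)%N%:R * (eta ^+ 2 * B%:R).
  by rewrite natrM !natrX; ring.
rewrite SE natrM natrX natrX -[leRHS]mulrA.
have := ler_wpM2l (exprn_ge0 n.+1 (ltW D0)) main; apply: le_trans.
by rewrite le_eqVlt; apply/orP; left; apply/eqP; ring.
Qed.

End Comb.

(** * Lower bound: rich graphs contain [F] *)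

(** If [E] were [F]-free, each comb would span at most [rho_FG R EF EG * #|EG|] edges of [EG];
    summed over all combs this contradicts the lower bound that [sum_all_combs] gives for each
    edge. *)
Lemma contains_of_comb (R : realType) (k : nat) (EF : {set 'I_k * 'I_k})
    (n : nat) (EG : {set 'I_n * 'I_n}) (alpha eta : R) (d B : nat)
    (r : 'I_n -> 'I_B -> 'I_d) (E : {set cube d * cube d}) :
  ograph_on (@ord_lt n) EG -> (0 < #|EG|)%N -> 0 <= eta <= 1 -> (0 < B)%N ->
  (forall (t t' : 'I_n) (b b' : 'I_B), (t < t')%N -> (r t b < r t' b')%N) ->
  (forall t, injective (r t)) ->
  ograph_on (@lexlt d) E -> (forall t b, rich_level alpha E (r t b)) ->
  rho_FG R EF EG * (eta ^+ 2 * B%:R) <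
    (1 - eta) ^+ n.-1 * (alpha * (eta ^+ 2 * B%:R) - 2 * n%:R) ->
  contains EF (@lexlt d) E.
Proof.
move=> EGo EG0 /andP[eta0 eta1] B0 r_lt r_inj Elt rich_r big.
apply: contraTT big => EF'; rewrite -leNgt.
set q := eta ^+ 2 * B%:R; have q0 : 0 <= q by rewrite mulr_ge0 ?sqr_ge0.
(* [W] is the number of triples [lam], [v], [z]. *)
set c := _ * (_ - _); pose W : R := B%:R ^+ n * (2 ^+ d) ^+ n.+1.
have W0 : 0 < W by rewrite mulr_gt0// exprn_gt0 ?ltr0n// exprn_gt0.
have G0 : 0 < #|EG|%:R :> R by rewrite ltr0n.
pose X lam v z := [set p in EG | (comb r lam v z p.1, comb r lam v z p.2) \in E].
have XF lam v z : ~~ contains EF (@ord_lt n) (X lam v z).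
  apply: contra EF'; apply: (contains_map (f := comb r lam v z)).
    by move=> i j; exact: comb_lt.
  by move=> i j; rewrite inE => /andP[].
have Xle lam v z : #|X lam v z|%:R <= rho_FG R EF EG * #|EG|%:R.
  by apply: le_rho_FG => //; apply/subsetP => p; rewrite inE => /andP[].
have up : (\sum_lam \sum_v \sum_z #|X lam v z|)%:R <= rho_FG R EF EG * #|EG|%:R * W.
  rewrite natr_sum; under eq_bigr => lam _ do
    (rewrite natr_sum; under eq_bigr => v _ do rewrite natr_sum).
  apply: (@le_trans _ _ (\sum_(lam : {ffun 'I_n -> 'I_B}) \sum_(v : cube d)
      \sum_(z : {ffun 'I_n -> cube d}) rho_FG R EF EG * #|EG|%:R)).
    by apply: ler_sum => lam _; apply: ler_sum => v _; apply: ler_sum.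
  rewrite !sumr_const card_cube !card_ffun !card_ord card_bool -!mulrnA -[leLHS]mulr_natr.
  by rewrite le_eqVlt; apply/orP; left; apply/eqP; rewrite /W !natrM !natrX exprS; ring.
have lo : c * W * #|EG|%:R <= (\sum_lam \sum_v \sum_z #|X lam v z|)%:R * q.
  rewrite (_ : (\sum_lam _)%N = (\sum_(p in EG) \sum_lam \sum_v \sum_z
     ((comb r lam v z p.1, comb r lam v z p.2) \in E))%N).
    rewrite natr_sum mulr_suml mulr_natr -sumr_const; apply: ler_sum => p pG.
    by apply: sum_all_combs => //; exact: EGo.
  rewrite [RHS]exchange_big; apply: eq_bigr => lam _.
  rewrite [RHS]exchange_big; apply: eq_bigr => v _.
  rewrite [RHS]exchange_big; apply: eq_bigr => z _ /=.
  rewrite -sum1_card /X (eq_bigl _ _ (fun p => in_set _ p)) big_mkcondr.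
  by apply: eq_bigr => p _; case: (_ \in E).
rewrite -(ler_pM2r (mulr_gt0 W0 G0)).
have := le_trans lo (ler_wpM2r q0 up); rewrite mulrA => /le_trans; apply.
by rewrite le_eqVlt; apply/orP; left; apply/eqP; ring.
Qed.

Lemma bernoulli (R : realType) (x : R) (m : nat) : 0 <= x <= 1 -> 1 - m%:R * x <= (1 - x) ^+ m.
Proof.
move=> /andP[x0 x1]; elim: m => [|m IH]; first by rewrite mul0r subr0 expr0.
rewrite exprS -natr1; have m0 : 0 <= m%:R :> R by [].
have x1' : 0 <= 1 - x by rewrite subr_ge0.
have := ler_wpM2l x1' IH; apply: le_trans; nra.
Qed.

Lemma rich_contains (R : realType) (k : nat) (EF : {set 'I_k * 'I_k})
    (n : nat) (EG : {set 'I_n * 'I_n}) (alpha : R) :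
  ograph_on (@ord_lt n) EG -> (0 < #|EG|)%N -> rho_FG R EF EG < alpha <= 1 ->
  exists C : nat, forall (d : nat) (E : {set cube d * cube d}),
    ograph_on (@lexlt d) E -> rich alpha C E -> contains EF (@lexlt d) E.
Proof.
move=> EGo EG0 /andP[ba a1]; set beta := rho_FG R EF EG in ba *.
have b0 : 0 <= beta by exact: rho_FG_ge0.
have n0 : (0 < n)%N by have /card_gt0P[[i _] _] := EG0; apply: leq_ltn_trans (ltn_ord i).
have n0' : 1 <= n%:R :> R by rewrite ler1n.
pose e := alpha - beta; have e0 : 0 < e by rewrite subr_gt0.
have e1 : e <= 1 by rewrite /e; lra.
have n4 : 0 < 4 * n%:R :> R by lra.
(* With this [eta], Bernoulli gives [(1 - eta) ^+ n.-1] at least [1 - e / 4]. *)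
have [eta etaE] : exists eta, 4 * n%:R * eta = e.
  by exists (e / (4 * n%:R)); rewrite mulrC divfK// gt_eqF.
have eta0 : 0 < eta by rewrite -(pmulr_rgt0 _ n4) etaE.
have eta1 : eta <= 1 by nra.
(* Makes the loss [2 * n] from atypical points at most a quarter of [e * (eta ^+ 2 * B)]. *)
pose B := (Num.bound (8 * n%:R / (eta ^+ 2 * e))).+1.
have eB : 8 * n%:R <= e * (eta ^+ 2 * B%:R).
  rewrite mulrA [e * _]mulrC [leRHS]mulrC -ler_pdivrMr ?mulr_gt0 ?exprn_gt0//. apply: ltW.
  apply: (@lt_trans _ _ (Num.bound (8 * n%:R / (eta ^+ 2 * e)))%:R); last by rewrite ltr_nat.
  by apply: archi_boundP; rewrite divr_ge0 ?mulr_ge0 ?sqr_ge0// ltW.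
exists (n * B)%N => d E Elt Erich.
pose L := enum [set i : 'I_d | rich_level alpha E i].
have sL : (n * B <= size L)%N by rewrite -cardE.
have d0 : (0 < d)%N.
  apply: (@leq_trans (n * B)); first by rewrite muln_gt0 n0.
  by rewrite (leq_trans Erich)// -[leqRHS]card_ord max_card.
pose i0 := Ordinal d0.
(* The increasing list of rich levels is cut into [n] consecutive blocks of length [B]; by [idx] the
   default [i0] is never returned. *)
pose r (t : 'I_n) (b : 'I_B) := nth i0 L (t * B + b).
have idx (t : 'I_n) (b : 'I_B) : (t * B + b < size L)%N.
  apply: leq_trans sL; apply: (@leq_trans (t.+1 * B)).
    by rewrite mulSn addnC ltn_add2r.
  by rewrite leq_mul2r ltn_ord orbT.
have L_sorted : sorted (relpre val ltn) L.
  have -> : L = filter (mem [set i : 'I_d | rich_level alpha E i]) (enum 'I_d).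
    by rewrite /L enumT.
  apply: sorted_filter; first by move=> ? ? ?; exact: ltn_trans.
  by rewrite -sorted_map val_enum_ord iota_ltn_sorted.
apply: (@contains_of_comb R k EF n EG alpha eta d B r) => //.
- by rewrite (ltW eta0).
- move=> t t' b b' tt'.
  apply: (sorted_ltn_nth (leT := relpre val ltn)) => //; rewrite ?inE //.
    by move=> ? ? ?; exact: ltn_trans.
  apply: (@leq_trans (t.+1 * B)); first by rewrite mulSn addnC ltn_add2r.
  by apply: leq_trans (leq_addr _ _); rewrite leq_mul2r tt' orbT.
- move=> t b b' /eqP; rewrite nth_uniq ?enum_uniq// eqn_add2l => /eqP bb'.
  exact: val_inj.
- move=> t b; have : r t b \in L by exact: mem_nth.
  by rewrite mem_enum inE.
have q0 : 0 < eta ^+ 2 * B%:R by rewrite mulr_gt0 ?exprn_gt0 ?ltr0n.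
have etan : (1 - e / 4) <= (1 - eta) ^+ n.-1.
  have h : 0 <= eta <= 1 by rewrite (ltW eta0).
  apply: le_trans (bernoulli n.-1 h).
  have : n.-1%:R <= n%:R :> R by rewrite ler_nat leq_pred.
  rewrite -/beta; nra.
set q := eta ^+ 2 * B%:R in eB q0 *.
apply: (@lt_le_trans _ _ ((1 - e / 4) * (alpha * q - 2 * n%:R))); last first.
  by rewrite ler_wpM2r// subr_ge0; rewrite /e in eB; nra.
have : alpha * q - e / 4 * q <= alpha * q - 2 * n%:R by lra.
(* As [alpha <= 1], two losses of at most [e / 4] each leave more than [beta = alpha - e]. *)
have : beta * q < (1 - e / 4) * ((alpha - e / 4) * q).
  by rewrite [ltRHS]mulrA ltr_pM2r//; rewrite /e in e0 e1 *; nra.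
move=> h1 h2; apply: (lt_le_trans h1); rewrite ler_wpM2l//; lra.
Qed.

(** * Comparison of the two infima *)

(** The complete graph contains [F], so an [F]-free subgraph misses an edge; taking [k.+2] vertices
    ensures an edge even for [k = 0]. *)
Lemma rho_FG_complete_lt1 (R : realType) (k : nat) (EF : {set 'I_k * 'I_k}) :
  ograph_on (@ord_lt k) EF ->
  exists (n : nat) (EG : {set 'I_n * 'I_n}),
    [/\ ograph_on (@ord_lt n) EG, (0 < #|EG|)%N & rho_FG R EF EG < 1].
Proof.
move=> EFo; pose EG : {set 'I_k.+2 * 'I_k.+2} := [set p | ord_lt p.1 p.2].
have EG0 : (0 < #|EG|)%N by apply/card_gt0P; exists (ord0, ord_max); rewrite inE.
exists k.+2, EG; split=> //; first by move=> p; rewrite inE.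
apply: (@le_lt_trans _ _ (#|EG|.-1%:R / #|EG|%:R)); last first.
  by rewrite ltr_pdivrMr ?ltr0n// mul1r ltr_nat prednK.
apply: rho_FG_le => //; first by rewrite divr_ge0.
move=> E' E'G E'F; rewrite divfK ?pnatr_eq0 -?lt0n// ler_nat -ltnS prednK//.
apply: proper_card; rewrite properEneq E'G andbT; apply: contra E'F => /eqP ->.
apply/existsP; exists [ffun i => widen_ord (leqW (leqnSn k)) i]; apply/andP; split.
  by apply/forallP => a; apply/forallP => b; apply/implyP => ab; rewrite !ffunE.
by apply/forallP => p; apply/implyP => /EFo pF; rewrite inE !ffunE.
Qed.

Local Open Scope classical_set_scope.

Theorem theorem1p2 (R : realType) (k : nat) (EF : {set 'I_k * 'I_k})
  (hF : ograph_on (@ord_lt k) EF) :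
  rho_F R EF =
  inf [set alpha : R | 0 <= alpha <= 1 /\
        exists C : nat, forall (d : nat) (E : {set cube d * cube d}),
          ograph_on (@lexlt d) E -> rich alpha C E ->
          contains EF (@lexlt d) E].
Proof.
set A := [set alpha | _].
have memA n (EG : {set 'I_n * 'I_n}) (alpha : R) : ograph_on (@ord_lt n) EG ->
    (0 < #|EG|)%N -> rho_FG R EF EG < alpha <= 1 -> A alpha.
  move=> EGo EG0 ba; split; last exact: rich_contains ba.
  by have /andP[/ltW/(le_trans (rho_FG_ge0 R EF EG)) -> ->] := ba.
have [n0 [EG0 [EG0o EG0_gt0 EG0_lt1]]] := rho_FG_complete_lt1 R hF.
(* Membership of 1 makes [inf A] a genuine infimum, not the default value of an empty set. *)
have A1 : A 1 by apply: (memA n0 EG0) => //; rewrite EG0_lt1 lexx.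
have Alb : has_lbound A by exists 0 => alpha [/andP[]].
apply/eqP; rewrite eq_le; apply/andP; split.
  apply: lb_le_inf; first by exists 1.
  by move=> alpha [/andP[alpha0 _] [C HC]]; exact: rho_F_le HC.
apply: lb_le_inf; first by exists (rho_FG R EF EG0), n0, EG0.
move=> _ [n [EG [EGo [EG_gt0 ->]]]].
have [rho1|rho1] := leP 1 (rho_FG R EF EG).
  exact: le_trans (ge_inf Alb A1) rho1.
apply/ler_addgt0Pr => e e0.
(* Capped at 1, which members of [A] may not exceed. *)
apply: (@le_trans _ _ (Num.min (rho_FG R EF EG + e) 1)); last by rewrite ge_min lexx.
apply: ge_inf => //; apply: (memA n EG) => //.
by rewrite lt_min ltrDl e0 rho1 ge_min lexx orbT.
Qed.
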